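(* Let $X$ be a regular curve and let $f:X\to X$ be a homeomorphism. Then $\Omega(f)=R(f)$, i.e. the set of non-wandering points of $f$ equals the set of recurrent points of $f$.
   Context: A continuum is a nonempty connected compact metric space. A continuum $X$ is a regular curve if for each $x\in X$ and each open neighborhood $V$ of $x$ in $X$ there is an open neighborhood $U$ of $x$ in $X$ with $U\subset V$ and with finite boundary $\partial U$. $\mathbb{N}$ denotes the positive integers. For a continuous map $f:X\to X$ of a compact metric space $(X,d)$ and $x\in X$, the $\omega$-limit set is $\omega_f(x)=\{y\in X:\exists\, n_i\in\mathbb{N},\ n_i\to\infty,\ \lim_{i\to\infty}d(f^{n_i}(x),y)=0\}$. A point $x$ is recurrent for $f$ if $x\in\omega_f(x)$; $R(f)$ is the set of recurrent points. A point $x$ is wandering for $f$ if there is a neighborhood $U$ of $x$ with $f^{-n}(U)\cap U=\emptyset$ for every $n\in\mathbb{N}$; otherwise $x$ is non-wandering. $\Omega(f)$ is the set of non-wandering points. *)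

(* Defs.v *)
From HB Require Import structures.
From mathcomp Require Import all_boot all_order all_algebra.
From mathcomp Require Import all_classical all_reals all_analysis.

Set Implicit Arguments.
Unset Strict Implicit.
Unset Printing Implicit Defensive.

Import Order.TTheory GRing.Theory Num.Theory.
Import numFieldTopology.Exports.

Local Open Scope classical_set_scope.
Local Open Scope ring_scope.

Definition boundary (T : topologicalType) (A : set T) : set T :=
  closure A `\` interior A.

Definition homeomorphism (T U : topologicalType) (f : T -> U) : Prop :=
  continuous f /\
  exists g : U -> T, [/\ cancel f g, cancel g f & continuous g].

Definition continuum (R : realType) (X : metricType R) : Prop :=
  [/\ [set: X] !=set0, connected [set: X] & compact [set: X]].

Definition regular_curve (R : realType) (X : metricType R) : Prop :=
  continuum X /\
  forall (x : X) (V : set X), open_nbhs x V ->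
    exists U : set X,
      [/\ open_nbhs x U, U `<=` V & finite_set (boundary U)].

Definition omega_limit (R : realType) (X : metricType R) (f : X -> X) (x : X) :
    set X :=
  [set y | exists n : nat -> nat,
    [/\ forall i, (0 < n i)%N,
        n i @[i --> \oo] --> \oo &
        mdist (iter (n i) f x) y @[i --> \oo] --> (0 : R)]].

Definition recurrent_set (R : realType) (X : metricType R) (f : X -> X) :
    set X :=
  [set x | omega_limit f x x].

Definition wandering (T : topologicalType) (f : T -> T) (x : T) : Prop :=
  exists2 U : set T, nbhs x U &
    forall n : nat, (0 < n)%N -> (iter n f @^-1` U) `&` U = set0.

Definition nonwandering_set (T : topologicalType) (f : T -> T) : set T :=
  [set x | ~ wandering f x].

(* Main.v *)
Require Import Defs.
From mathcomp Require Import all_boot all_order all_algebra.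
From mathcomp Require Import finmap.
From mathcomp Require Import all_classical all_reals all_analysis.
From mathcomp Require Import zify.

(* Let g be the inverse of f, and suppose that the non-wandering point x is not
   recurrent, so that some neighbourhood U0 of x contains no f^n x with n > 0.

   If U0 contains no g^n x with n > 0 either, let U be a neighbourhood of x in
   U0 whose boundary has the least possible number k of points. A small
   connected neighbourhood K of x has infinitely many images f^n K meeting K
   and leaving U, so some p in the boundary of U lies in f^(n_i) K for
   infinitely many n_i. The sets f^(n_i) U, for k + 2 of these times, pairwise
   overlap, while f^(n_i) x lies in none of the others. Removing from each set
   the closures of the others leaves cuts around the f^(n_i) x, with at least k
   boundary points each; since this uncrossing does not increase the total
   number of boundary points, no boundary point of one set lies in two others.
   But connectedness of f^(n_i) K puts a point of the boundary of f^(n_0) U in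
   each of the k + 1 other sets: contradiction.

   Otherwise the points g^n x return to x. Choose 2N return times growing fast
   enough that any two of the points g^(v_a + v_b) x, with a < N <= b, are
   separated by the sets f^(-v_c) U for at least two of the indices c. They lie
   in N^2 distinct atoms of these sets, each with a boundary point, and these
   boundary points are distinct; but there are only linearly many (in N) of
   them. *)

Set Implicit Arguments.
Unset Strict Implicit.
Unset Printing Implicit Defensive.

Import Order.TTheory GRing.Theory Num.Theory.

Local Open Scope classical_set_scope.

(** * Finite sets, boundaries and connectedness *)

Lemma injective_card_fset_set (I : finType) (X : choiceType) (A : set X)
    (h : I -> X) :
  finite_set A -> injective h -> (forall i, A (h i)) ->
  (#|I| <= #|` fset_set A|)%N.
Proof.
move=> finA injh Ah; rewrite cardE -(size_map h); apply: uniq_leq_size.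
  by rewrite map_inj_uniq ?enum_uniq.
by move=> _ /mapP[i _ ->]; rewrite in_fset_set// inE; exact: Ah.
Qed.

Lemma card_fset_set_preimage (X : choiceType) (h h' : X -> X) (A : set X) :
  cancel h h' -> cancel h' h -> finite_set A ->
  finite_set (h @^-1` A) /\
  #|` fset_set (h @^-1` A)| = #|` fset_set A|.
Proof.
move=> hK h'K finA.
have -> : h @^-1` A = h' @` A.
  apply/seteqP; split=> [y /= Ay|_ [z Az <-] /=]; last by rewrite h'K.
  by exists (h y); rewrite ?hK.
split; first exact: finite_image.
by rewrite fset_set_image// card_imfset//=; exact: can_inj h'K.
Qed.

Lemma near_finite (I : choiceType) (T : Type) (F : set_system T)
    (FF : Filter F) (A : set I) (Q : I -> T -> Prop) :
  finite_set A -> (forall i, A i -> \forall y \near F, Q i y) ->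
  \forall y \near F, forall i, A i -> Q i y.
Proof.
move=> finA AQ.
apply: filterS (@filter_bigI T I (fset_set A) Q F FF _) => [y|i].
  by rewrite fset_setK// => Qy i Ai; exact: Qy.
by rewrite in_fset_set// inE => /AQ.
Qed.

Lemma open_boundaryE (T : topologicalType) (U : set T) :
  open U -> boundary U = closure U `\` U.
Proof. by move=> /interior_id; rewrite /boundary => ->. Qed.

Lemma open_disjoint_closure (T : topologicalType) (U A : set T) (z : T) :
  open U -> U z -> closure A z -> exists2 y, A y & U y.
Proof.
move=> oU Uz Az.
by have [y [Ay Uy]] := Az U (open_nbhs_nbhs (conj oU Uz)); exists y.
Qed.

Lemma connected_meets_boundary (T : topologicalType) (K U : set T) (y z : T) :
  connected K -> open U -> K y -> U y -> K z -> ~ U z ->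
  exists2 p, K p & boundary U p.
Proof.
move=> cK oU Ky Uy Kz nUz; apply: contrapT => nex; apply: nUz.
suff KU : K `&` U = K by move: Kz; rewrite -KU => -[].
apply: cK; [by exists y|by exists U|exists (closure U)].
  exact: closed_closure.
apply/seteqP; split=> [p [Kp Up]|p [Kp cUp]]; split=> //.
  exact: subset_closure.
by apply: contrapT => nUp; apply: nex; exists p; rewrite ?open_boundaryE.
Qed.

Lemma nbhs_closure_subset (T : uniformType) (x : T) (U : set T) :
  nbhs x U -> exists2 V, open_nbhs x V & closure V `<=` U.
Proof.
move=> /uniform_regular[V nV VU]; exists V°.
  by rewrite open_nbhsE; split; [exact: open_interior|exact: nbhs_interior].
by apply: subset_trans VU; apply: closureS; exact: interior_subset.
Qed.

(** * Iterates of a homeomorphism *)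

Definition inverse_homeos (T : topologicalType) (f g : T -> T) : Prop :=
  [/\ continuous f, continuous g, cancel f g & cancel g f].

Lemma inverse_homeosC (T : topologicalType) (f g : T -> T) :
  inverse_homeos f g -> inverse_homeos g f.
Proof. by case. Qed.

Lemma continuous_iter (T : topologicalType) (f : T -> T) (n : nat) :
  continuous f -> continuous (iter n f).
Proof.
move=> cf; elim: n => [|n IHn] x; first exact: cvg_id.
by apply: continuous_comp; [exact: IHn|exact: cf].
Qed.

Lemma cancel_iter (T : Type) (f g : T -> T) (n : nat) :
  cancel f g -> cancel (iter n f) (iter n g).
Proof.
move=> fK; elim: n => [//|n IHn] x.
by rewrite iterSr iterS fK; exact: IHn.
Qed.

Lemma inverse_homeos_iter (T : topologicalType) (f g : T -> T) (n : nat) :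
  inverse_homeos f g -> inverse_homeos (iter n f) (iter n g).
Proof.
by case=> cf cg fK gK; split; by [apply: continuous_iter|apply: cancel_iter].
Qed.

Lemma closure_preimage_homeo (T : topologicalType) (f g : T -> T) (A : set T) :
  inverse_homeos f g -> closure (f @^-1` A) = f @^-1` (closure A).
Proof.
move=> [cf cg fK gK]; apply/seteqP; split=> [z /= cz V hV|z /= cz V nV].
  by have [y [Ay Vy]] := cz (f @^-1` V) (cf _ _ hV); exists (f y).
have [|y [Ay Vy]] := cz (g @^-1` V); first by apply: cg; rewrite /= fK.
by exists (g y); split=> //=; rewrite gK.
Qed.

Lemma boundary_preimage_homeo (T : topologicalType) (f g : T -> T)
    (A : set T) :
  inverse_homeos f g -> boundary (f @^-1` A) = f @^-1` (boundary A).
Proof.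
move=> fg.
have bdE B : boundary B = closure B `&` closure (~` B).
  by rewrite /boundary -{2}(setCK B) interiorC setDE setCK.
by rewrite !bdE preimage_setI -!(closure_preimage_homeo _ fg) preimage_setC.
Qed.

(** * Neighbourhoods with smallest boundary *)

Definition mincut (R : realType) (X : metricType R) (x : X) (U0 U : set X) :
    Prop :=
  [/\ open_nbhs x U, U `<=` U0, finite_set (boundary U) &
    forall G, open_nbhs x G -> G `<=` U0 -> finite_set (boundary G) ->
      (#|` fset_set (boundary U)| <= #|` fset_set (boundary G)|)%N].

Lemma mincut_exists (R : realType) (X : metricType R) (x : X) (U0 : set X) :
  regular_curve X -> open_nbhs x U0 -> exists U, mincut x U0 U.
Proof.
move=> [_ regX] nU0.
pose P k := `[< exists U, [/\ open_nbhs x U, U `<=` U0,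
  finite_set (boundary U) & #|` fset_set (boundary U)| = k] >].
have exP : exists k, P k.
  have [U [nU UU0 finU]] := regX x U0 nU0.
  by exists #|` fset_set (boundary U)|; apply/asboolP; exists U.
case: (ex_minnP exP) => k /asboolP[U [nU UU0 finU cardU]] kmin.
exists U; split=> // G nG GU0 finG; rewrite cardU; apply: kmin.
by apply/asboolP; exists G.
Qed.

Lemma connected_clopenT (T : topologicalType) (A : set T) (x : T) :
  connected [set: T] -> open A -> closed A -> ~ A x -> A = set0.
Proof.
move=> cT oA cA nAx; apply: contrapT => /eqP/set0P A0; apply: nAx.
have -> // : A = [set: T].
by apply: cT => //; exists A; rewrite ?setTI.
Qed.

(* If the closure split, the piece containing x would be a cut whose boundary
   is no larger, hence all of the boundary of U; the other piece would then be
   clopen in X. *)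
Lemma mincut_connected (R : realType) (X : metricType R) (x : X)
    (U0 U : set X) :
  connected [set: X] -> mincut x U0 U -> connected (closure U).
Proof.
move=> cX [nU UU0 finU minU]; have [oU Ux] := nU.
have cUx : closure U x by exact: subset_closure.
have main C D : open C -> closed D -> closure U `&` C = closure U `&` D ->
    C x -> closure U `<=` C.
  move=> oC cD CD Cx.
  have nG : open_nbhs x (U `&` C) by split; [exact: openI|].
  have GU0 : U `&` C `<=` U0 by move=> y [/UU0].
  have bdG : boundary (U `&` C) `<=` boundary U `&` C.
    rewrite !open_boundaryE//; last exact: openI.
    move=> y [cGy nGy].
    have cUy : closure U y by apply: closureS cGy => z [].
    have Dy : D y.
      rewrite (closure_id D).1//; apply: closureS cGy => z [Uz Cz].
      have : (closure U `&` C) z by split=> //; exact: subset_closure.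
      by rewrite CD => -[].
    have [_ Cy] : (closure U `&` C) y by rewrite CD.
    by split=> //; split=> // Uy; apply: nGy.
  have finG : finite_set (boundary (U `&` C)).
    by apply: sub_finite_set finU => y /bdG[].
  (* Minimality of [U] turns the inclusion [bdG] into an equality of boundaries, so all of
     [boundary U] lies in [C]. *)
  have bdUG : boundary U `<=` boundary (U `&` C).
    have /eqP/(fset_set_inj finG finU) -> // :
        fset_set (boundary (U `&` C)) == fset_set (boundary U).
      rewrite eqEfcard; apply/andP; split; last exact: minU.
      by rewrite -fset_set_sub// => y /bdG[].
  have E : closure U `\` C = U `\` D.
    apply/seteqP; split=> y [].
      move=> cUy nCy; split.
        apply: contrapT => nUy; apply: nCy.
        have /bdUG/bdG[] // : boundary U y.
        by rewrite open_boundaryE.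
      move=> Dy; apply: nCy.
      by have [] : (closure U `&` C) y by rewrite CD.
    move=> Uy nDy; have cUy := subset_closure Uy; split=> // Cy; apply: nDy.
    by have [] : (closure U `&` D) y by rewrite -CD.
  suff K0 : closure U `\` C = set0.
    by move=> y cUy; apply: contrapT => nCy; rewrite -[False]/(set0 y) -K0.
  apply: (@connected_clopenT _ _ x) => //.
  - by rewrite E setDE; apply: openI => //; exact: closed_openC.
  - rewrite setDE; apply: closedI; first exact: closed_closure.
    exact: open_closedC.
  - by case.
move=> B [y By] [C oC BC] [D cD BD].
have CD : closure U `&` C = closure U `&` D by rewrite -BC.
have [Cx|nCx] := pselect (C x).
  rewrite BC; apply/seteqP; split=> [z []//|z cUz]; split=> //.
  exact: main CD Cx _ cUz.
have nDx : ~ D x.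
  by move=> Dx; apply: nCx; have [] : (closure U `&` C) x by rewrite CD.
(* With [x] outside [C], the complements exchange roles: [~] D[is open,]~[C] is closed, and [main]
   applies to them. *)
have CD' : closure U `&` ~` D = closure U `&` ~` C.
  apply/seteqP; split=> z [cUz nz]; split=> // z'; apply: nz.
    by have [] : (closure U `&` D) z by rewrite -CD.
  by have [] : (closure U `&` C) z by rewrite CD.
have /(_ y) := main _ _ (closed_openC cD) (open_closedC oC) CD' nDx.
by move: By; rewrite BD => -[cUy Dy] /(_ cUy).
Qed.

(** * Late returns of a non-wandering point *)

Lemma near_iter_notin (T : topologicalType) (f : T -> T) (x : T) (C : set T)
    (M : nat) :
  continuous f -> closed C -> (forall n, (0 < n)%N -> ~ C (iter n f x)) ->
  \forall y \near x, forall n, (0 < n <= M)%N -> ~ C (iter n f y).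
Proof.
move=> cf cC Cx.
have : \forall y \near x, forall n, `I_M.+1 n ->
    (0 < n)%N -> ~ C (iter n f y).
  apply: near_finite; first exact: finite_II.
  move=> n _; case: (posnP n) => [->|n0]; first by near=> y.
  have : nbhs (iter n f x) (~` C).
    apply: open_nbhs_nbhs; split; [exact: closed_openC|exact: Cx].
  by move=> /(@continuous_iter _ f n cf x) nC; near=> y => n0'; near: y.
by apply: filterS => y H n /andP[n0 nM]; exact: H.
Unshelve. all: by end_near.
Qed.

(** Near [x] no point comes back to [U0] within the first [M] steps, so a return provided by
    non-wandering is late. *)
Lemma nonwandering_late (T : topologicalType) (f : T -> T) (x : T)
    (U0 V : set T) (M : nat) :
  continuous f -> nonwandering_set f x -> nbhs x U0 ->
  (forall n, (0 < n)%N -> ~ closure U0 (iter n f x)) -> nbhs x V ->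
  exists n y, [/\ (M < n)%N, V y & V (iter n f y)].
Proof.
move=> cf nw nU0 U0x nV; apply: contrapT => nex; apply: nw.
have nR := near_iter_notin M cf (@closed_closure _ U0) U0x.
exists (V `&` U0 `&` [set y | forall n, (0 < n <= M)%N ->
  ~ closure U0 (iter n f y)]); first by do 2![apply: filterI => //].
move=> n n0; rewrite -subset0 => y [[[Vn U0n] _] [[Vy U0y] Ry]].
case: (leqP n M) => nM; last by apply: nex; exists n, y.
by apply: (Ry n); [rewrite n0|exact: subset_closure].
Qed.

Lemma iter_cancel_leq (T : Type) (f g : T -> T) (m n : nat) (y : T) :
  cancel f g -> (m <= n)%N -> iter m g (iter n f y) = iter (n - m) f y.
Proof.
by move=> fK mn; rewrite -[in LHS](subnKC mn) iterD cancel_iter.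
Qed.

(** When [f^n K] meets [K] it has a point in [U], and also [f^n x] outside [U], so it meets
    [boundary U]. This happens at arbitrarily late times, and the boundary is finite. *)
Lemma hit_boundary_infinitely_often (R : realType) (X : metricType R)
    (f g : X -> X) (x : X) (U0 U K : set X) :
  inverse_homeos f g -> nonwandering_set f x -> nbhs x U0 ->
  (forall n, (0 < n)%N -> ~ closure U0 (iter n f x)) ->
  open U -> U `<=` U0 -> finite_set (boundary U) ->
  nbhs x K -> connected K -> K `<=` U ->
  exists2 p, boundary U p &
    forall M, exists2 n, (M < n)%N & K (iter n g p).
Proof.
move=> [cf cg fK gK] nw nU0 U0x oU UU0 finU nK cK KU.
apply: contrapT => nex.
have H p : boundary U p -> \forall n \near \oo, ~ K (iter n g p).
  move=> bp; apply: contrapT => nK'; apply: nex; exists p => // M.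
  apply: contrapT => nM; apply: nK'; exists M.+1 => // n /= Mn Kn.
  by apply: nM; exists n.
have [M _ HM] : \forall n \near \oo, forall p, boundary U p ->
    ~ K (iter n g p) by apply: near_finite.
have [n [y [Mn Ky Kny]]] := nonwandering_late M cf nw nU0 U0x nK.
have cfK : connected (iter n f @` K).
  apply: connected_continuous_connected => //.
  by apply: continuous_subspaceT; exact: continuous_iter.
have [||||p [z Kz <-] bp] := connected_meets_boundary (y := iter n f y)
    (z := iter n f x) cfK oU.
- by exists y.
- exact: KU.
- by exists x => //; exact: nbhs_singleton.
- by move=> Ux; apply: (U0x n); [lia|apply: subset_closure; exact: UU0].
- by apply: (HM n) bp _; [rewrite /=; lia|rewrite cancel_iter].
Qed.

(** * Atoms and uncrossing *)

(** Taking away closures, not just the sets, keeps atoms open; for [pred1 i] this is [V i] minus the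
    closures of all the others. *)
Definition atom (T : topologicalType) (I : finType) (V : I -> set T)
    (S : pred I) : set T :=
  [set y | forall i, if S i then V i y else ~ closure (V i) y].

Lemma open_atom (T : topologicalType) (I : finType) (V : I -> set T)
    (S : pred I) :
  (forall i, open (V i)) -> open (atom V S).
Proof.
move=> oV; rewrite openE => y Vy; apply: filter_forall => i.
have := Vy i; case: (S i) => Viy; first exact: open_nbhs_nbhs.
by apply: open_nbhs_nbhs; split=> //; exact/closed_openC/closed_closure.
Qed.

Lemma boundary_atom (T : topologicalType) (I : finType) (V : I -> set T)
    (S : pred I) (z : T) :
  (forall i, open (V i)) -> boundary (atom V S) z ->
  [/\ forall i, S i -> closure (V i) z, forall i, ~~ S i -> ~ V i z &
    exists i, boundary (V i) z].
Proof.
move=> oV; rewrite open_boundaryE; last exact: open_atom.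
move=> [cz nz].
have cl i : S i -> closure (V i) z.
  by move=> Si; apply: closureS cz => y /(_ i); rewrite Si.
have nV i : ~~ S i -> ~ V i z.
  move=> /negbTE Si Viz.
  have [y Ay Viy] := open_disjoint_closure (oV i) Viz cz.
  by have := Ay i; rewrite Si; apply; exact: subset_closure.
split=> //; apply: contrapT => nex; apply: nz => i.
have nb : ~ boundary (V i) z by move=> b; apply: nex; exists i.
rewrite open_boundaryE// in nb.
case: ifPn => Si.
  by apply: contrapT => nVi; apply: nb; split=> //; exact: cl.
by move=> cVi; apply: nb; split=> //; exact: nV.
Qed.

Lemma card_fset_set_sum (X : choiceType) (A B : set X) :
  finite_set B -> A `<=` B ->
  #|` fset_set A| = (\sum_(z <- fset_set B) `[< A z >])%N.
Proof.
move=> finB AB; have finA := sub_finite_set AB finB.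
rewrite -[RHS]big_mkcond/= sum1_count -size_filter.
apply: perm_size; apply: uniq_perm; rewrite ?filter_uniq//.
move=> z; rewrite mem_filter in_fset_set// in_fset_set//.
rewrite (_ : z \in A = `[< A z >])//.
by apply/idP/andP => [Az|[]//]; split=> //; rewrite inE; apply/AB/asboolP.
Qed.

(* Subtracting the other closures from each V i does not create boundary
   points, counted with multiplicity; a boundary point lying in two of the
   sets would be lost, against the hypothesis. *)
Lemma boundary_uncrossing (T : topologicalType) (I : finType)
    (V : I -> set T) (i i' j : I) (z : T) :
  (forall i, open (V i)) -> (forall i, finite_set (boundary (V i))) ->
  (forall i, (#|` fset_set (boundary (V i))| <=
    #|` fset_set (boundary (atom V (pred1 i)))|)%N) ->
  boundary (V j) z -> V i z -> V i' z -> i = i'.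
Proof.
move=> oV finV leV bz Viz Vi'z; apply/eqP/contraT => ii'.
pose B := \bigcup_i boundary (V i).
have finB : finite_set B by apply: bigcup_finite => //; exact: finite_finset.
have VB l : boundary (V l) `<=` B by move=> y ?; exists l.
have AB l : boundary (atom V (pred1 l)) `<=` B.
  by move=> y /(boundary_atom oV)[_ _ [m]]; exact: VB.
pose a l y : nat := `[< boundary (V l) y >].
pose b l y : nat := `[< boundary (atom V (pred1 l)) y >].
have b0 l m y : V m y -> l != m -> b l y = 0%N.
  move=> Vmy lm; rewrite /b; case: asboolP => // /(boundary_atom oV)[_ + _].
  by move=> /(_ m); rewrite /= eq_sym => /(_ lm).
have a1 y l : boundary (V l) y -> (0 < \sum_l a l y)%N.
  by move=> bly; rewrite (bigD1 l)//= /a; case: asboolP.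
have le_ba y : y \in fset_set B -> (\sum_l b l y <= \sum_l a l y)%N.
  rewrite in_fset_set// inE => -[l _ bly].
  (* A point inside some [V m] can be on the boundary of the [m]-th atom only, so it counts at most
     once on the left. A point in no [V m] that bounds an atom bounds the corresponding set. *)
  have [[m Vmy]|nV] := pselect (exists m, V m y).
    rewrite (bigD1 m)//= big1 ?addn0 => [|p pm]; last exact: b0 Vmy pm.
    by apply: leq_trans (leq_b1 _) (a1 _ _ bly).
  apply: leq_sum => p _; rewrite /a /b; case: asboolP => // bp.
  case: asboolP => // -[]; rewrite open_boundaryE//; split.
    by have [+ _ _] := boundary_atom oV bp => /(_ p); apply; exact: eqxx.
  by move=> Vpy; apply: nV; exists p.
have : (\sum_(y <- fset_set B) \sum_l b l y <
        \sum_(y <- fset_set B) \sum_l a l y)%N.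
  have zB : z \in fset_set B by rewrite in_fset_set// inE; exact: (VB j).
  rewrite (bigD1_seq z) ?fset_uniq//=.
  rewrite [X in (_ < X)%N](bigD1_seq z) ?fset_uniq//=.
  (* At [z] the inequality is strict: lying in both [V i] and [V i'], it bounds none of the atoms,
     yet it bounds [V j]. *)
  have b0z : (\sum_l b l z = 0)%N.
    rewrite big1// => l _.
    by have [->|] := eqVneq l i; [exact: b0 Vi'z ii'|exact: b0].
  rewrite b0z add0n -[X in (X < _)%N]add0n.
  apply: (@leq_add 1); first exact: a1 bz.
  rewrite big_seq_cond [leqRHS]big_seq_cond.
  by apply: leq_sum => y /andP[/le_ba].
rewrite exchange_big [X in (_ < X)%N]exchange_big/= ltnNge => /negP; case.
apply: leq_sum => l _.
by rewrite -(card_fset_set_sum finB (VB l)) -(card_fset_set_sum finB (AB l)).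
Qed.

(** * Neither orbit of [x] returns *)

Lemma increasing_choice (P : nat -> nat -> Prop) :
  (forall M, exists n, P M n) ->
  exists n : nat -> nat, forall i, P (n i) (n i.+1).
Proof.
by move=> /choice[s Ps]; exists (fun i => iter i s 0%N) => i; exact: Ps.
Qed.

Lemma nonwandering_two_sided (R : realType) (X : metricType R)
    (f g : X -> X) (x : X) (U0 : set X) :
  regular_curve X -> inverse_homeos f g -> nonwandering_set f x ->
  open_nbhs x U0 -> (forall n, (0 < n)%N -> ~ closure U0 (iter n f x)) ->
  ~ (forall n, (0 < n)%N -> ~ closure U0 (iter n g x)).
Proof.
move=> regX fg nw nU0 fx gx.
have [_ _ fK gK] := fg; have [[_ cX _] _] := regX.
have [U [nU UU0 finU minU]] := mincut_exists regX nU0.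
have [oU Ux] := nU.
(* The closure of the minimal cut [W] is connected; choosing [W] inside [V0] keeps that closure
   within [U]. *)
have [V0 nV0 V0U] := nbhs_closure_subset (open_nbhs_nbhs nU).
have [W mW] := mincut_exists regX nV0.
have cK := mincut_connected cX mW.
set K := closure W in cK.
have [nW WV0 _ _] := mW.
have KU : K `<=` U by apply: subset_trans V0U; exact: closureS.
have nK : nbhs x K.
  by apply: filterS (open_nbhs_nbhs nW); exact: subset_closure.
have [p bp pK] := hit_boundary_infinitely_often fg nw (open_nbhs_nbhs nU0) fx
  oU UU0 finU nK cK KU.
have [t tP] : exists t : nat -> nat, forall i,
    (t i < t i.+1)%N /\ K (iter (t i.+1) g p).
  apply: (increasing_choice (P := fun M n => (M < n)%N /\ K (iter n g p))).
  by move=> M; have [n] := pK M; exists n.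
set k := #|` fset_set (boundary U)| in minU.
(* The shift skips [t 0], about which nothing is known. One time gives the reference set, the other
   [k.+1] overfill its boundary. *)
pose n (i : 'I_k.+2) := t i.+1.
have nK' i : K (iter (n i) g p) by have [] := tP i.
have t_lt : {homo t : i j / (i < j)%N}.
  by apply: homo_ltn => [|i]; [exact: ltn_trans|have [] := tP i].
pose V i := iter (n i) g @^-1` U.
have fgn i := inverse_homeos_iter (n i) fg.
have gfn i := inverse_homeosC (fgn i).
have oV i : open (V i).
  by have [_ cgn _ _] := fgn i; move/continuousP : cgn; exact.
have bV i : boundary (V i) = iter (n i) g @^-1` boundary U.
  exact: boundary_preimage_homeo (gfn i).
have cardV i : finite_set (boundary (V i)) /\
    #|` fset_set (boundary (V i))| = k.
  by rewrite bV; have [_ _ fKn gKn] := fgn i; exact: card_fset_set_preimage.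
have finV i : finite_set (boundary (V i)) by have [] := cardV i.
have sep i j : i != j -> ~ closure U (iter (n j) g (iter (n i) f x)).
  move=> ij /(closureS UU0).
  case: (ltngtP (n i) (n j)) => nij.
  - rewrite -(subnK (ltnW nij)) iterD cancel_iter//; apply: gx; lia.
  - rewrite iter_cancel_leq//; [apply: fx; lia|lia].
  - case: (ltngtP i j) => ij'.
    + by have := t_lt i.+1 j.+1 ij'; rewrite /n in nij; lia.
    + by have := t_lt j.+1 i.+1 ij'; rewrite /n in nij; lia.
    + by move/val_inj/eqP : ij'; rewrite (negbTE ij).
have sepV i j : i != j -> ~ closure (V j) (iter (n i) f x).
  by rewrite (closure_preimage_homeo _ (gfn j)); exact: sep.
(* Pulled back by [f^(n i)], the atom becomes a neighbourhood of [x] inside [U0], to which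
   minimality of [U] applies. *)
have leV i : (#|` fset_set (boundary (V i))| <=
    #|` fset_set (boundary (atom V (pred1 i)))|)%N.
  have finA : finite_set (boundary (atom V (pred1 i))).
    apply: (@sub_finite_set _ _ (\bigcup_j boundary (V j))).
      by move=> y /(boundary_atom oV)[_ _ [m]]; exists m.
    by apply: bigcup_finite => //; exact: finite_finset.
  have [cfn _ fKn gKn] := fgn i.
  have [finG cardG] := card_fset_set_preimage fKn gKn finA.
  rewrite -(boundary_preimage_homeo _ (fgn i)) in finG cardG.
  rewrite -cardG; have [_ ->] := cardV i; apply: minU => //.
    split; first by move/continuousP : cfn; apply; exact: open_atom.
    move=> l /=; case: eqVneq => [->|li].
      by rewrite /V /= cancel_iter.
    by apply: sepV; rewrite eq_sym.
  move=> y /(_ i)/=; rewrite eqxx /V /= cancel_iter//; exact: UU0.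
(* [f^(n l) K] lies in [V l] and joins [p], a point of [V ord0], to [f^(n l) x], which is not
   one. *)
have hit l : l != ord0 -> exists z, boundary (V ord0) z /\ V l z.
  move=> l0; have [cfn _ fKn gKn] := fgn l.
  have cfK : connected (iter (n l) f @` K).
    apply: connected_continuous_connected => //.
    exact: continuous_subspaceT.
  have [||||z [y Ky <-] bz] := connected_meets_boundary (y := p)
      (z := iter (n l) f x) cfK (oV ord0).
  - by exists (iter (n l) g p).
  - exact/KU/nK'.
  - by exists x => //; exact: nbhs_singleton.
  - by move=> /subset_closure; exact: sepV.
  - exists (iter (n l) f y); split=> //.
    by rewrite /V /= cancel_iter//; exact: KU.
have /choice[z zP] : forall i : 'I_k.+1, exists z,
    boundary (V ord0) z /\ V (lift ord0 i) z.
  by move=> i; exact: hit.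
have injz : injective z.
  move=> i j zij; have [bi Vi] := zP i; have [_ Vj] := zP j.
  rewrite -zij in Vj.
  exact: lift_inj (boundary_uncrossing oV finV leV bi Vi Vj).
have := injective_card_fset_set (finV ord0) injz (fun i => (zP i).1).
by have [_ ->] := cardV ord0; rewrite card_ord ltnn.
Qed.

(** * Only the backward orbit returns *)

Lemma card_fset_set_bigcup (I : finType) (X : choiceType) (A : I -> set X) :
  (forall i, finite_set (A i)) ->
  (#|` fset_set (\bigcup_i A i)| <= \sum_i #|` fset_set (A i)|)%N.
Proof.
move=> finA.
have finB : finite_set (\bigcup_i A i).
  by apply: bigcup_finite => //; exact: finite_finset.
have AB i : A i `<=` \bigcup_i A i by move=> y; exists i.
rewrite (card_fset_set_sum finB (@subset_refl _ _)).
under [X in (_ <= X)%N]eq_bigr => i _ do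
  rewrite (card_fset_set_sum finB (AB i)).
rewrite exchange_big/= big_seq_cond [leqRHS]big_seq_cond.
apply: leq_sum => z /andP[]; rewrite in_fset_set// inE => -[i _ Aiz] _.
by rewrite (bigD1 i)//=; case: asboolP => _ //=; case: asboolP.
Qed.

(* The orbit of a nonperiodic point of F leaves F for ever, and x is not on
   the finitely many periodic orbits meeting F. *)
Lemma near_no_late_return (T : topologicalType) (f g : T -> T) (x : T)
    (F : set T) :
  hausdorff_space T -> cancel f g -> (forall n, (0 < n)%N -> iter n f x <> x) ->
  finite_set F ->
  exists D, \forall z \near x, forall n d, (D <= d)%N ->
    F (iter n f z) -> ~ F (iter d f (iter n f z)).
Proof.
move=> hT fK aper finF.
pose periodic r := exists2 q, (0 < q)%N & iter q f r = r.
have injf n : injective (iter n f) by exact: can_inj (cancel_iter n fK).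
(* Two visits of the orbit of [r] to the same [q] would make [r] periodic, so each pair [r], [q]
   rules out finitely many times. *)
have [D _ HD] : \forall d \near \oo, forall r, F r -> ~ periodic r ->
    forall q, F q -> iter d f r <> q.
  apply: near_finite => // r Fr; have [pr|npr] := pselect (periodic r).
    by near=> d.
  suff : \forall d \near \oo, forall q, F q -> iter d f r <> q.
    by apply: filterS => d H _.
  apply: near_finite => // q Fq.
  have [[d0 d0q]|nq] := pselect (exists d0, iter d0 f r = q); last first.
    by near=> d => dq; apply: nq; exists d.
  exists d0.+1 => // d /= d0d dq; apply: npr; exists (d - d0)%N; first by lia.
  by apply: (injf d0); rewrite -iterD subnKC ?d0q//; exact: ltnW.
have near_per : \forall z \near x, forall r, F r -> periodic r ->
    forall n, iter n f z <> r.
  apply: near_finite => // r Fr; have [pr|npr] := pselect (periodic r);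
    last first.
    by near=> z.
  have [q q0 qr] := pr.
  have qmr m : iter (m * q) f r = r.
    by elim: m => // m IHm; rewrite mulSn iterD IHm.
  have : \forall z \near x, forall j, `I_q j -> z <> iter j f r.
    apply: near_finite; first exact: finite_II.
    move=> j _.
    suff : nbhs x (~` [set iter j f r]) by [].
    apply: open_nbhs_nbhs; split.
      apply: closed_openC; apply: accessible_closed_set1.
      exact: hausdorff_accessible.
    by move=> /= xj; apply: (aper q q0); rewrite xj -iterD addnC iterD qr.
  apply: filterS => z zC _ n nr.
  (* The exponent is [- n] modulo the period [q]: as [f^n z = r], the point [z] is itself on the
     orbit of [r], which [zC] excludes. *)
  apply: (zC ((n * q - n) %% q)%N); first by rewrite /= ltn_mod.
  apply: (injf n); rewrite nr.
  have -> : iter ((n * q - n) %% q) f r = iter (n * q - n) f r.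
    by rewrite [in RHS](divn_eq (n * q - n) q) addnC iterD qmr.
  by rewrite -iterD subnKC ?qmr// leq_pmulr.
exists D; near=> z => n d Dd Fz.
have npr : ~ periodic (iter n f z).
  move=> pr; suff : iter n f z <> iter n f z by [].
  by move: n Fz pr; near: z; apply: filterS near_per => z zP n Fz pr; exact: zP.
by move=> Fd; exact: (HD d Dd _ Fz npr _ Fd).
Unshelve. all: by end_near.
Qed.

(** A return [n <= M] into the set of points avoiding [U0] for [M] steps is impossible, since [f^n]
    brings [g^n x] back to [x]. *)
Lemma late_return (T : topologicalType) (f g : T -> T) (x : T)
    (U0 V : set T) (M : nat) :
  continuous f -> cancel g f -> nbhs x U0 ->
  (forall n, (0 < n)%N -> ~ closure U0 (iter n f x)) ->
  (forall V, nbhs x V -> exists2 n, (0 < n)%N & V (iter n g x)) ->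
  nbhs x V -> exists n, (M < n)%N /\ V (iter n g x).
Proof.
move=> cf gK nU0 fx gx nV.
have nR := near_iter_notin M cf (@closed_closure _ U0) fx.
have [n n0 [Vn Rn]] := gx _ (filterI nV nR).
exists n; split=> //; rewrite ltnNge; apply/negP => nM.
have /Rn : (0 < n <= M)%N by rewrite n0.
by rewrite cancel_iter//; apply; apply: subset_closure; exact: nbhs_singleton.
Qed.

(** Each new time is chosen so that [g^(v b) x] imitates [x] under the earlier iterates. The factor
    2 makes [v c] exceed [v a + v b] for [a < b < c]; [D] spaces the times for the late-return
    bound. *)
Lemma fast_return_times (T : topologicalType) (f g : T -> T) (x : T)
    (U0 U U' : set T) (D : nat) :
  inverse_homeos f g -> nbhs x U0 ->
  (forall n, (0 < n)%N -> ~ closure U0 (iter n f x)) ->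
  (forall V, nbhs x V -> exists2 n, (0 < n)%N & V (iter n g x)) ->
  U `<=` U0 -> open U' -> U' x -> U' `<=` U ->
  exists v : nat -> nat,
    (forall i j, (i < j)%N -> (2 * v i + D < v j)%N) /\
    forall a b, (a < b)%N ->
      let y := iter (v a) g (iter (v b) g x) in
      [/\ U' y, U (iter (v a) f y), U (iter (v b) f y) &
        forall c, c != a -> c != b -> ~ closure U (iter (v c) f y)].
Proof.
move=> fg nU0 fx gx UU0 oU' U'x U'U; have [cf cg fK gK] := fg.
have fxU n : (0 < n)%N -> ~ closure U (iter n f x).
  by move=> n0 /(closureS UU0); exact: fx.
(* Only open properties pass from [x] to [y], for exponents up to [m]: membership in [U'] and
   avoidance of [closure U]. *)
pose V m := [set y | forall l, `I_m.+1 l ->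
  (U' (iter l g x) -> U' (iter l g y)) /\
  forall l', `I_m.+1 l' -> ~ closure U (iter l' f (iter l g x)) ->
    ~ closure U (iter l' f (iter l g y))].
have nV m : nbhs x (V m).
  apply: near_finite; first exact: finite_II.
  move=> l _; apply: filterI.
    have [U'l|nU'l] := pselect (U' (iter l g x)); last by near=> y.
    have : nbhs (iter l g x) U' by exact: open_nbhs_nbhs.
    move=> /(@continuous_iter _ g l cg x) nU'.
    by near=> y => _; near: y.
  apply: near_finite; first exact: finite_II.
  move=> l' _.
  have [cU|ncU] := pselect (closure U (iter l' f (iter l g x))).
    by near=> y.
  have : nbhs (iter l' f (iter l g x)) (~` closure U).
    apply: open_nbhs_nbhs; split=> //; exact/closed_openC/closed_closure.
  move=> /(@continuous_iter _ f l' cf) /(@continuous_iter _ g l cg x) nC.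
  by near=> y => _; near: y.
have Vle m m' : (m <= m')%N -> V m' `<=` V m.
  move=> mm' y Vy l /= lm; have [|U'l Vl] := Vy l; first by rewrite /=; lia.
  by split=> // l' /= l'm; apply: Vl; rewrite /=; lia.
have [u uP] : exists u : nat -> nat, forall i,
    (2 * u i + D < u i.+1)%N /\ V (u i) (iter (u i.+1) g x).
  apply: (increasing_choice (P := fun M n =>
    (2 * M + D < n)%N /\ V M (iter n g x))) => M.
  exact: late_return cf gK nU0 fx gx (nV M).
have u_lt : {homo u : i j / (i < j)%N}.
  by apply: homo_ltn => [|i]; [exact: ltn_trans|have [] := uP i; lia].
have u_le i j : (i <= j)%N -> (u i <= u j)%N.
  by rewrite leq_eqVlt => /predU1P[->//|/u_lt/ltnW].
pose v i := u i.+1.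
have v_gap i j : (i < j)%N -> (2 * v i + D < v j)%N.
  move=> ij; have [+ _] := uP i.+1 => /leq_trans; apply.
  exact: (u_le i.+2 j.+1).
have Vv a b : (a < b)%N -> V (v a) (iter (v b) g x).
  move=> ab; have [_] := uP b; apply: Vle; exact: (u_le a.+1 b).
have vU' a : U' (iter (v a) g x).
  by have [_ Va] := uP a; have [+ _] := Va 0%N (ltn0Sn _); exact.
have v0 a : (0 < v a)%N by rewrite (leq_trans _ (u_lt a a.+1 _)).
exists v; split=> // a b ab /=; split.
- by have [+ _] := Vv _ _ ab (v a) (ltnSn _); apply.
- by rewrite cancel_iter//; exact: U'U.
- by rewrite -iterD addnC iterD cancel_iter//; exact: U'U.
(* For [c < a], closeness replaces first [g^(v b) x] and then [g^(v a) x] by [x]; for [a < c < b]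
   only the former; for [b < c] the point is a forward iterate of [x]. *)
move=> c ca cb; have [cb'|bc|/eqP] := ltngtP c b; last by rewrite (negbTE cb).
  have [ca'|ac|/eqP] := ltngtP c a; last by rewrite (negbTE ca).
    have [_ +] := Vv _ _ ab (v a) (ltnSn _); apply.
      by rewrite /=; have := v_gap _ _ ca'; lia.
    have [_ +] := Vv _ _ ca' 0%N (ltn0Sn _); apply; first exact: ltnSn.
    exact: fxU.
  have vac := v_gap _ _ ac.
  have [|_ +] := Vv _ _ cb' (v a); first by rewrite /=; lia.
  apply; first exact: ltnSn.
  have le_ac : (v a <= v c)%N by lia.
  by rewrite -(subnK le_ac) iterD cancel_iter//; apply: fxU; lia.
have vbc := v_gap _ _ bc; have vab := v_gap _ _ ab.
have le_abc : (v b + v a <= v c)%N by lia.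
by rewrite -iterD addnC -(subnK le_abc) iterD cancel_iter//; apply: fxU; lia.
Unshelve. all: by end_near.
Qed.

Lemma not_nonwandering_one_sided (R : realType) (X : metricType R)
    (f g : X -> X) (x : X) (U0 : set X) :
  regular_curve X -> inverse_homeos f g ->
  open_nbhs x U0 -> (forall n, (0 < n)%N -> ~ closure U0 (iter n f x)) ->
  ~ (forall V, nbhs x V -> exists2 n, (0 < n)%N & V (iter n g x)).
Proof.
move=> regX fg nU0 fx gx.
have [cf cg fK gK] := fg; have [[_ cX _] regX'] := regX.
have [U [nU UU0 finU]] := regX' x U0 nU0.
have [oU Ux] := nU.
have aper n : (0 < n)%N -> iter n f x <> x.
  move=> n0 nx; apply: (fx n n0); rewrite nx; apply/subset_closure/UU0.
  exact: Ux.
have [D nG] := near_no_late_return (@metric_hausdorff _ X) fK aper finU.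
(* Boundary points of atoms inside [U'] lie only in its closure, so the closure must stay where late
   returns to [boundary U] are barred. *)
have [V0 nV0 V0G] := nbhs_closure_subset (filterI (open_nbhs_nbhs nU) nG).
have [U' [nU' U'V0 finU']] := regX' x V0 nV0.
have [oU' U'x] := nU'.
have cU'G := subset_trans (closureS U'V0) V0G.
have U'U : U' `<=` U by move=> y /subset_closure/cU'G[].
have [v [v_gap vP]] := fast_return_times D fg (open_nbhs_nbhs nU0) fx gx UU0
  oU' U'x U'U.
pose k := maxn #|` fset_set (boundary U')| #|` fset_set (boundary U)|.
(* With this value [(2 * N + 1) * k < N ^ 2], as the final count requires. *)
pose N := (2 * k + 2)%N.
pose V (o : option 'I_(N + N)) := if o is Some c then iter (v c) f @^-1` U
  else U'.
have fgv c := inverse_homeos_iter (v c) fg.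
have oV o : open (V o).
  case: o => [c|] //=; have [cfc _ _ _] := fgv c.
  by move/continuousP : cfc; exact.
have bV c : boundary (V (Some c)) = iter (v c) f @^-1` boundary U.
  exact: boundary_preimage_homeo (fgv c).
have cV c : closure (V (Some c)) = iter (v c) f @^-1` closure U.
  exact: closure_preimage_homeo (fgv c).
have finV o : finite_set (boundary (V o)) /\
    (#|` fset_set (boundary (V o))| <= k)%N.
  case: o => [c|]; last by split; [|exact: leq_maxl].
  have [_ _ fKc gKc] := fgv c.
  by have [] := card_fset_set_preimage fKc gKc finU; rewrite bV => ? ->;
    split; [|exact: leq_maxr].
pose S (ab : 'I_N * 'I_N) : pred (option 'I_(N + N)) := fun o =>
  if o is Some c then (c == lshift N ab.1) || (c == rshift N ab.2) else true.
have bd_atom ab : exists z, boundary (atom V (S ab)) z.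
  have oA := open_atom (S ab) oV.
  apply: contrapT => nex.
  have clA : closed (atom V (S ab)).
    move=> z cz; apply: contrapT => nz; apply: nex; exists z.
    by rewrite open_boundaryE.
  have nAfx : ~ atom V (S ab) (f x).
    move=> /(_ None)/= U'fx; apply: (fx 1%N) => //=.
    exact/subset_closure/UU0/U'U.
  have A0 := connected_clopenT cX oA clA nAfx.
  have lt_ab : (lshift N ab.1 < rshift N ab.2)%N.
    by rewrite /= ltn_addr.
  have [U'y Uay Uby ncy] := vP _ _ lt_ab.
  set y := iter _ g _ in U'y Uay Uby ncy.
  suff : atom V (S ab) y by rewrite A0.
  move=> [c|] //=; rewrite -/(V (Some c)) cV.
  case: eqVneq => [->//|ca]; case: eqVneq => [->//|cb] /=.
  exact: ncy.
have /choice[z zP] := bd_atom.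
have injz : injective z.
  move=> [a b] [a' b'] zab.
  apply/eqP/contraT => neq.
  (* Of two distinct pairs, each has an index the other lacks. A common boundary point is in the
     closures of [V (Some c)] and [V (Some c')] but in neither set. *)
  have [c [c' [Sc nSc' Sc' nSc]]] : exists c c', [/\ S (a, b) (Some c),
      ~~ S (a, b) (Some c'), S (a', b') (Some c') & ~~ S (a', b') (Some c)].
    have lr (i j : 'I_N) : (lshift N i == rshift N j) = false.
      by apply/eqP => /(congr1 val)/= ij; have := ltn_ord i; lia.
    have rl (i j : 'I_N) : (rshift N i == lshift N j) = false.
      by rewrite eq_sym lr.
    have [aa'|aa'] := eqVneq a a'.
      exists (rshift N b), (rshift N b').
      have bb' : b != b' by move: neq; rewrite aa' xpair_eqE eqxx.
      by rewrite /S /= !rl !eq_rshift !eqxx (eq_sym b') (negbTE bb').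
    exists (lshift N a), (lshift N a').
    by rewrite /S /= !lr !eq_lshift !eqxx (eq_sym a') (negbTE aa').
  have [cl nV _] := boundary_atom oV (zP (a, b)).
  have [cl' nV' _] := boundary_atom oV (zP (a', b')).
  rewrite -zab in cl' nV'.
  have bc : boundary U (iter (v c) f (z (a, b))).
    have : boundary (V (Some c)) (z (a, b)).
      by rewrite open_boundaryE//; split; [exact: cl|exact: nV'].
    by rewrite bV.
  have bc' : boundary U (iter (v c') f (z (a, b))).
    have : boundary (V (Some c')) (z (a, b)).
      by rewrite open_boundaryE//; split; [exact: cl'|exact: nV].
    by rewrite bV.
  have [_ Gz] := cU'G _ (cl None isT).
  (* A boundary point shared by two atoms would visit the boundary of U at two
     times more than D apart. *)
  have late (i j : nat) : (i < j)%N -> boundary U (iter (v i) f (z (a, b))) ->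
      ~ boundary U (iter (v j) f (z (a, b))).
    move=> ij bi; have := v_gap i j ij => vij.
    have le_ij : (v i <= v j)%N by lia.
    by rewrite -(subnK le_ij) iterD; apply: Gz => //; lia.
  case: (ltngtP c c') => [cc'|cc'|/val_inj cc'].
  - by case: (late _ _ cc' bc bc').
  - by case: (late _ _ cc' bc' bc).
  - by move: nSc'; rewrite -cc' Sc.
pose B := \bigcup_o boundary (V o).
have finB : finite_set B.
  by apply: bigcup_finite => [|o _]; [exact: finite_finset|have [] := finV o].
have zB ab : B (z ab).
  by have [_ _ [j bj]] := boundary_atom oV (zP ab); exists j.
have := injective_card_fset_set finB injz zB.
rewrite leqNgt => /negP; apply.
apply: leq_ltn_trans (card_fset_set_bigcup (fun o => (finV o).1)) _.
apply: leq_ltn_trans (leq_sum _ (fun o _ => (finV o).2)) _.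
rewrite sum_nat_const card_prod card_option !card_ord /N; lia.
Qed.

(** * Recurrence and the conclusion *)

Lemma nbhs_mdist_lt (R : realType) (X : metricType R) (x : X) (e : R) :
  (0 < e)%R -> nbhs x [set y | (mdist x y < e)%R].
Proof. by move=> e0; rewrite -ballEmdist; exact: nbhsx_ballx. Qed.

Lemma recurrent_nonwandering (R : realType) (X : metricType R) (f : X -> X) :
  recurrent_set f `<=` nonwandering_set f.
Proof.
move=> x [n [n0 _ nx]] [U nU Uw].
move: (nU) => /nbhs_ballP[e /= e0 eU].
have : \forall i \near \oo, (mdist (iter (n i) f x) x < e)%R.
  by move/cvgrPdist_lt : nx => /(_ e e0); apply: filterS => i;
    rewrite sub0r normrN; apply: le_lt_trans; exact: ler_norm.
move=> [i _ /(_ i (leqnn i))/= ie].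
suff : set0 x by [].
rewrite -(Uw (n i) (n0 i)); split; last exact: nbhs_singleton.
by apply: eU; rewrite ballEmdist /= metric_sym.
Qed.

(** Returns must be made arbitrarily late: by multiples of the period if [x] is periodic, otherwise
    by a neighbourhood that excludes the first iterates. *)
Lemma recurrent_of_returns (R : realType) (X : metricType R) (f : X -> X)
    (x : X) :
  continuous f ->
  (forall V, nbhs x V -> exists2 n, (0 < n)%N & V (iter n f x)) ->
  recurrent_set f x.
Proof.
move=> cf ret.
suff H i : exists n, (i < n)%N /\ (mdist x (iter n f x) < i.+1%:R^-1 :> R)%R.
  have /choice[n nP] := H.
  exists n; split.
  - by move=> i; have [] := nP i; lia.
  - apply/cvgnyPge => A; near=> i; have [+ _] := nP i.
    have : (A <= i)%N by near: i; exact: nbhs_infty_ge.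
    lia.
  - apply/cvgrPdist_lt => e e0; near=> i.
    rewrite sub0r normrN ger0_norm ?mdist_ge0// metric_sym.
    have [_ /lt_trans] := nP i; apply.
    by near: i; exact: near_infty_natSinv_lt (PosNum e0).
have [[q q0 qx]|aper] := pselect (exists2 q, (0 < q)%N & iter q f x = x).
  exists (i.+1 * q)%N; split; first by rewrite leq_pmulr.
  suff -> : iter (i.+1 * q) f x = x by rewrite mdistxx invr_gt0.
  by elim: i.+1 => // m IHm; rewrite mulSn iterD IHm.
have nV : \forall y \near x, forall n, `I_i.+1 n ->
    (0 < n)%N -> y <> iter n f x.
  apply: near_finite; first exact: finite_II.
  move=> n _; case: (posnP n) => [->|n0]; first by near=> y.
  suff nC : nbhs x (~` [set iter n f x]) by near=> y => _; near: y.
  apply: open_nbhs_nbhs; split.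
    apply: closed_openC; apply: accessible_closed_set1.
    exact/hausdorff_accessible/metric_hausdorff.
  by move=> /= xn; apply: aper; exists n.
have e0 : (0 < i.+1%:R^-1 :> R)%R by rewrite invr_gt0.
have [n n0 [nx dx]] := ret _ (filterI nV (nbhs_mdist_lt x e0)).
exists n; split=> //; rewrite ltnNge; apply/negP => ni.
exact: (nx n).
Unshelve. all: by end_near.
Qed.

Lemma not_recurrent_avoids (R : realType) (X : metricType R) (f : X -> X)
    (x : X) :
  continuous f -> ~ recurrent_set f x ->
  exists2 U, open_nbhs x U &
    forall n, (0 < n)%N -> ~ closure U (iter n f x).
Proof.
move=> cf nrec; apply: contrapT => nex; apply: nrec.
apply: recurrent_of_returns => // V nV; apply: contrapT => nn; apply: nex.
have [U nU UV] := nbhs_closure_subset nV.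
by exists U => // n n0 /UV Vn; apply: nn; exists n.
Qed.

Theorem theorem2p1 (R : realType) (X : metricType R) (f : X -> X)
    (hX : regular_curve X) (hf : homeomorphism f) :
  nonwandering_set f = recurrent_set f.
Proof.
have [cf [g [fK gK cg]]] := hf.
have fg : inverse_homeos f g by split.
apply/seteqP; split; last exact: recurrent_nonwandering.
move=> x nw; apply: contrapT => nrec.
have [U nU fx] := not_recurrent_avoids cf nrec.
have [grec|gnrec] := pselect
  (forall V, nbhs x V -> exists2 n, (0 < n)%N & V (iter n g x)).
  exact: not_nonwandering_one_sided hX fg nU fx grec.
have [V nV gx] : exists2 V, open_nbhs x V &
    forall n, (0 < n)%N -> ~ closure V (iter n g x).
  apply: contrapT => nex; apply: gnrec => V nV.
  apply: contrapT => nn; apply: nex; have [W nW WV] := nbhs_closure_subset nV.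
  by exists W => // n n0 /WV Vn; apply: nn; exists n.
have nUV : open_nbhs x (U `&` V) by exact: open_nbhsI.
apply: (nonwandering_two_sided hX fg nw nUV) => n n0.
  by move=> /closureI[/(fx n n0)].
by move=> /closureI[_ /(gx n n0)].
Qed.
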